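(* For all intensity functions $h$, the price of anarchy $PoA(h,x_e)$ satisfies $$\lim_{x_e\to 0}PoA(h,x_e)=1 .$$
   Context: Consider a single-server loss system (an arriving customer who finds the server busy balks) with general service distribution of average rate $\mu>0$ and the server located at the origin. An intensity function is any nonnegative function $h$ on $[0,\infty)$ for which $\lambda(x)=\int_0^x h(y)\,dy$ is finite for all $x\ge 0$; customers with distance less than $x$ from the server arrive as a Poisson process of rate $\lambda(x)$. The benefit from a completed service is $R$, the waiting cost per unit time in the system is $c_w$, the travel cost per unit distance is $c_t>0$ (travel is instantaneous), and $\frac{R\mu}{c_w}>1$. Under a threshold strategy $x$, a customer joins if and only if the server is idle and his distance is at most $x$. The Nash equilibrium threshold is $x_e=\frac{R\mu-c_w}{c_t\mu}$; it is treated as a positive parameter, with $\mu$ and $h$ fixed. The expected social benefit per unit time with threshold $x$ is $$S(x)=\frac{c_t\int_0^x (x_e-y)h(y)\,dy}{1+\frac1\mu\int_0^x h(y)\,dy}.$$ The socially optimal threshold $x^*$, which maximizes $S$, is given as the unique $x\ge 0$ satisfying $x_e=\frac1\mu\int_0^{x}(x-y)h(y)\,dy+x$; it depends on $x_e$, $h$ and $\mu$. The price of anarchy is $$PoA(h,x_e)=\frac{S(x^* )}{S(x_e)}=\frac{\int_{0}^{x^*} (x_e-y)h(y)\,dy}{\int_{0}^{x_e} (x_e-y)h(y)\,dy}\cdot\frac{1+\frac{1}{\mu} \int_{0}^{x_e} h(y)\,dy}{1+\frac{1}{\mu} \int_{0}^{x^*} h(y)\,dy}.$$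
   Formalization: The price of anarchy is 0/0 when h vanishes almost everywhere on [0,x_e] (e.g. h=0), so the limit is taken as x_e→0+ over those x_e with S(x_e)≠0; nothing is claimed for h that vanishes almost everywhere near 0, and for every other h this is the plain limit. *)

(* Defs.v *)
From mathcomp Require Import all_boot all_order all_algebra.
From mathcomp Require Import all_classical all_reals all_analysis.
Set Implicit Arguments.
Unset Strict Implicit.
Unset Printing Implicit Defensive.
Import Order.TTheory GRing.Theory Num.Theory.
Import numFieldNormedType.Exports.
Local Open Scope classical_set_scope.
Local Open Scope ring_scope.

(* The paper's functions live on [0, +oo[; here [h : R -> R], and its values on
   the negative half-line are irrelevant.  No regularity of h is assumed beyond
   (Lebesgue) integrability on each [0, x]. *)
Definition intensity (R : realType) (h : R -> R) : Prop :=
  (forall y : R, 0 <= y -> 0 <= h y) /\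
  (forall x : R, 0 <= x ->
     (@lebesgue_measure R).-integrable `[0, x] (EFin \o h)).

Definition social_benefit (R : realType) (ct mu : R) (h : R -> R) (xe x : R) : R :=
  ct * (\int[@lebesgue_measure R]_(y in `[0, x]) ((xe - y) * h y)) /
  (1 + mu^-1 * \int[@lebesgue_measure R]_(y in `[0, x]) h y).

Definition optimal_threshold_eq (R : realType) (mu : R) (h : R -> R) (xe x : R)
    : Prop :=
  xe = mu^-1 * (\int[@lebesgue_measure R]_(y in `[0, x]) ((x - y) * h y)) + x.

(* For 0 < mu, 0 < xe and h an intensity, the set below is a singleton (its
   defining equation has a right-hand side that is continuous, strictly
   increasing and unbounded in x, and 0 at x = 0), so the default value 0 of
   [xget] plays no role. *)
Definition optimal_threshold (R : realType) (mu : R) (h : R -> R) (xe : R) : R :=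
  xget 0 [set x | 0 <= x /\ optimal_threshold_eq mu h xe x].

Definition PoA (R : realType) (ct mu : R) (h : R -> R) (xe : R) : R :=
  social_benefit ct mu h xe (optimal_threshold mu h xe) /
  social_benefit ct mu h xe xe.

(* The closed form of the price of anarchy; in particular it does not depend on
   the travel cost ct. *)
Lemma PoAE (R : realType) (ct mu : R) (h : R -> R) (xe : R) :
  ct != 0 ->
  let x := optimal_threshold mu h xe in
  PoA ct mu h xe =
    (\int[@lebesgue_measure R]_(y in `[0, x]) ((xe - y) * h y)) /
    (\int[@lebesgue_measure R]_(y in `[0, xe]) ((xe - y) * h y)) *
    ((1 + mu^-1 * \int[@lebesgue_measure R]_(y in `[0, xe]) h y) /
     (1 + mu^-1 * \int[@lebesgue_measure R]_(y in `[0, x]) h y)).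
Proof.
move=> ct0 x; rewrite /PoA /social_benefit -/x !invfM invrK.
by rewrite mulrACA [ct * _ * _]mulrACA mulfV // mul1r [X in _ * X]mulrC.
Qed.

(* PoA is the quotient S(x^* ) / S(xe); it is meaningful only where its
   denominator is nonzero, i.e. when h does not vanish a.e. on [0, xe]. *)
Definition PoA_domain (R : realType) (ct mu : R) (h : R -> R) : set R :=
  [set xe | social_benefit ct mu h xe xe != 0].

(* Main.v *)
Require Import Defs.
From mathcomp Require Import all_boot all_order all_algebra.
From mathcomp Require Import all_classical all_reals all_analysis.
From mathcomp Require Import ring lra.
Set Implicit Arguments.
Unset Strict Implicit.
Unset Printing Implicit Defensive.
Import Order.TTheory GRing.Theory Num.Theory.
Import numFieldNormedType.Exports.
Local Open Scope classical_set_scope.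
Local Open Scope ring_scope.

(** Write L(x) and M(x) for the integrals of h(y) and y h(y) over [0, x], so
    that the numerator of S is xe L(x) - M(x).  The equation for the optimal
    threshold turns this numerator into mu (xe - x) (1 + L(x)/mu) at x = x*, from
    which S(x* ) >= S(xe) follows because the increment of M on [x*, xe] is at
    least x* times that of L.  Since x* <= xe, the numerator is at most the one
    at xe, so that 1 <= PoA <= 1 + L(xe)/mu, and L(xe) tends to 0 with xe. *)

Definition arrival_rate (R : realType) (h : R -> R) (x : R) : R :=
  \int[@lebesgue_measure R]_(y in `[0, x]) h y.

(** Taking this as the [arrival_rate] of another integrand lets the value at 0 and the continuity on
    [[0, x]] serve for both integrals. *)
Definition arrival_moment (R : realType) (h : R -> R) : R -> R :=
  arrival_rate (fun y => y * h y).

Lemma integrable_idM (R : realType) (h : R -> R) (x : R) :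
  (@lebesgue_measure R).-integrable `[0, x] (EFin \o h) ->
  (@lebesgue_measure R).-integrable `[0, x] (EFin \o (fun y => y * h y)).
Proof.
move=> hx.
have -> : EFin \o (fun y => y * h y) = ((EFin \o id) \* (EFin \o h))%E.
  by apply/funext => y /=; rewrite EFinM.
apply: integrableMr => //.
exists x; split; first exact: num_real.
move=> N xN y /=; rewrite in_itv/= => /andP[y0 yx].
by rewrite ger0_norm// (le_trans yx)// ltW.
Qed.

Lemma arrival_rate0 (R : realType) (h : R -> R) : arrival_rate h 0 = 0.
Proof. by rewrite /arrival_rate set_itv1 Rintegral_set1. Qed.

Lemma arrival_rate_continuous (R : realType) (h : R -> R) (x : R) :
  0 <= x -> (@lebesgue_measure R).-integrable `[0, x] (EFin \o h) ->
  {within `[0, x], continuous (arrival_rate h)}.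
Proof. exact: parameterized_integral_continuous. Qed.

Section intensity.
Context (R : realType) (h : R -> R).
Hypothesis h_int : intensity h.
Local Notation L := (arrival_rate h).
Local Notation M := (arrival_moment h).

Lemma intensity_integral_sub (a x : R) : 0 <= x ->
  \int[@lebesgue_measure R]_(y in `[0, x]) ((a - y) * h y) = a * L x - M x.
Proof.
move=> x0; have hx := h_int.2 _ x0.
under eq_Rintegral do rewrite mulrBl.
rewrite RintegralB//; first by rewrite RintegralZl.
- by apply: (integrableZl _ a hx).
- exact: integrable_idM.
Qed.

Lemma arrival_rate_nondecreasing (a b : R) : 0 <= a -> a <= b -> L a <= L b.
Proof.
move=> a0 ab; have b0 := le_trans a0 ab.
rewrite -subr_ge0 /arrival_rate (Rintegral_itvB (h_int.2 _ b0))//.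
by apply: Rintegral_ge0 => y /=; rewrite in_itv/= => /andP[ay _];
  apply: h_int.1; apply: (le_trans a0); apply: ltW.
Qed.

(** Both increments are integrals over []a, b]], where the weight [y] lies between [a] and [b] and
    [h] is nonnegative. *)
Lemma arrival_moment_sub_bounds (a b : R) : 0 <= a -> a <= b ->
  a * (L b - L a) <= M b - M a <= b * (L b - L a).
Proof.
move=> a0 ab; have b0 := le_trans a0 ab.
have hb := h_int.2 _ b0.
have mhb := integrable_idM hb.
have sab : `]a, b]%classic `<=` `[0, b]%classic.
  by move=> y /=; rewrite !in_itv/= => /andP[/ltW ay ->]; rewrite (le_trans a0).
have hab : (@lebesgue_measure R).-integrable `]a, b] (EFin \o h).
  by apply: integrableS hb.
have mhab : (@lebesgue_measure R).-integrable `]a, b]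
    (EFin \o (fun y => y * h y)).
  by apply: integrableS mhb.
rewrite /arrival_moment /arrival_rate (Rintegral_itvB hb)// (Rintegral_itvB mhb)//.
rewrite -!RintegralZl//; apply/andP; split; apply: le_Rintegral => //.
- by apply: (integrableZl _ a hab).
- move=> y /=; rewrite in_itv/= => /andP[/ltW ay _].
  by rewrite ler_wpM2r// h_int.1// (le_trans a0).
- by apply: (integrableZl _ b hab).
- move=> y /=; rewrite in_itv/= => /andP[/ltW ay yb].
  by rewrite ler_wpM2r// h_int.1// (le_trans a0).
Qed.

(** The intermediate value theorem on [[0, xe]] provides a root, so [xget] returns a genuine
    solution instead of its default. The right-hand side [F] of the threshold equation is 0 at 0,
    and [F xe >= xe] because [M xe <= xe * L xe]. *)
Lemma optimal_thresholdP (mu xe : R) : 0 < mu -> 0 <= xe ->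
  0 <= optimal_threshold mu h xe /\
  optimal_threshold_eq mu h xe (optimal_threshold mu h xe).
Proof.
move=> mu0 xe0.
suff : [set x | 0 <= x /\ optimal_threshold_eq mu h xe x] !=set0.
  exact: xgetPex.
have hxe := h_int.2 _ xe0.
have Lcont := arrival_rate_continuous xe0 hxe.
have Mcont : {within `[0, xe], continuous M}.
  exact: arrival_rate_continuous (integrable_idM hxe).
pose F x := mu^-1 * (x * L x - M x) + x.
have F0 : F 0 = 0.
  by rewrite /F /arrival_moment !arrival_rate0 mulr0 subrr mulr0 addr0.
have Fxe : xe <= F xe.
  have /andP[_] := arrival_moment_sub_bounds (lexx 0) xe0.
  rewrite /arrival_moment !arrival_rate0 !subr0 => Mxe.
  by rewrite /F lerDr mulr_ge0 ?invr_ge0 ?(ltW mu0)// subr_ge0.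
have idcont : {within `[0, xe], continuous (id : R -> R)}.
  by apply: continuous_subspaceT => y; exact: cvg_id.
have Fcont : {within `[0, xe], continuous F}.
  move=> x; apply: cvgD; last exact: idcont.
  apply: cvgM; first exact: cvg_cst.
  apply: cvgB; last exact: Mcont.
  apply: cvgM; last exact: Lcont.
  exact: idcont.
have [|x] := IVT xe0 Fcont (v := xe).
  by rewrite F0 le_max ge_min xe0 Fxe orbT.
rewrite in_itv/= => /andP[x0 _] Fx; exists x; split => //.
by rewrite /optimal_threshold_eq intensity_integral_sub// -/(F x) Fx.
Qed.

Lemma PoA_bounds (ct mu xe : R) : 0 < ct -> 0 < mu -> 0 < xe ->
  PoA_domain ct mu h xe -> 1 <= PoA ct mu h xe <= 1 + mu^-1 * L xe.
Proof.
move=> ct0 mu0 xe0; have xe0' := ltW xe0.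
rewrite /PoA_domain/= /social_benefit.
have [] := optimal_thresholdP mu0 xe0'.
rewrite PoAE /=; last exact: lt0r_neq0.
set x := optimal_threshold mu h xe => x0.
rewrite /optimal_threshold_eq !intensity_integral_sub// -!/(arrival_rate _ _).
have i0 : 0 < mu^-1 by rewrite invr_gt0.
move: (mu^-1) i0 => i i0 xE G0.
have := arrival_moment_sub_bounds (lexx 0) x0.
rewrite /arrival_moment !arrival_rate0 !subr0 mul0r -/(arrival_moment _) => /andP[_ Mx].
have xxe : x <= xe by rewrite xE lerDr mulr_ge0 ?(ltW i0)// subr_ge0.
have /andP[dM1 dM2] := arrival_moment_sub_bounds x0 xxe.
have := arrival_moment_sub_bounds (lexx 0) xe0'.
rewrite /arrival_moment !arrival_rate0 !subr0 mul0r -/(arrival_moment _) => /andP[_ Mxe].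
have La := arrival_rate_nondecreasing (lexx 0) x0.
rewrite arrival_rate0 in La.
have Lab := arrival_rate_nondecreasing x0 xxe.
(* Membership in [PoA_domain] excludes equality in [M xe <= xe * L xe]. *)
have {G0} Gpos : 0 < xe * L xe - M xe.
  rewrite lt_def subr_ge0 Mxe andbT.
  by move: G0; apply: contraNN => /eqP ->; rewrite mulr0 mul0r.
(* Only real arithmetic remains, with [a], [b] the rates and [m], [n] the moments at [x] and
   [xe]. *)
move: (L x) (L xe) (M x) (M xe) xE Mx dM1 dM2 Mxe La Lab Gpos.
move=> a b m n xE Mx dM1 dM2 Mxe La Lab Gpos.
have Apos : 0 < 1 + i * a by rewrite ltr_wpDr// mulr_ge0// ltW.
have Bpos : 0 < 1 + i * b.
  by rewrite ltr_wpDr// mulr_ge0 ?(ltW i0)// (le_trans La).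
rewrite mulf_div ler_pdivlMr ?mulr_gt0// ler_pdivrMr ?mulr_gt0//.
rewrite mul1r; apply/andP; split.
(* Lower bound: [E] brings out the factor [1 + i * a] on the right, which cancels. What is left
   amounts to [x * (b - a) <= n - m], that is [dM1]. *)
- have E : i * (x * a - m) = xe - x by rewrite [in RHS]xE addrK.
  rewrite -(ler_pM2l i0) !mulrA.
  have -> : i * (xe * a - m) = (xe - x) * (1 + i * a).
    by rewrite [RHS]mulrDr mulr1 -{1}E; ring.
  rewrite [leRHS]mulrAC ler_pM2r//.
  have -> : (xe - x) * (1 + i * b) = i * (x * a - m + (xe - x) * b).
    by rewrite [LHS]mulrDr mulr1 -{1}E; ring.
  by rewrite ler_pM2l//; lra.
(* Upper bound: [1 + i * b] cancels, [dM2] gives [xe * a - m <= xe * b - n], and the remaining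
   factor [1 + i * a] is at least 1. *)
- rewrite [leLHS]mulrC ler_pM2l//.
  apply: (@le_trans _ _ (xe * b - n)); first by lra.
  by rewrite ler_peMr ?(ltW Gpos)// lerDl mulr_ge0// ltW.
Qed.

(** This is right continuity at 0, read off from continuity on [[0, 1]]; any positive right endpoint
    would do. *)
Lemma arrival_rate_cvg0 : L x @[x --> 0^'+] --> (0 : R).
Proof.
have /(continuous_within_itvP _ ltr01)[_ + _] :=
  arrival_rate_continuous ler01 (h_int.2 _ ler01).
by rewrite arrival_rate0.
Qed.

End intensity.

Theorem proposition3p2 (R : realType) (ct mu : R) (h : R -> R)
    (ct_gt0 : 0 < ct) (mu_gt0 : 0 < mu) (h_int : intensity h) :
  PoA ct mu h xe @[xe --> within (PoA_domain ct mu h) 0^'+] --> (1 : R).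
Proof.
apply: (@squeeze_cvgr _ _ _ _ (cst 1) (fun xe => 1 + mu^-1 * arrival_rate h xe)).
- rewrite near_withinE; near=> xe => xeD.
  by apply: PoA_bounds => //; near: xe; exact: nbhs_right_gt.
- exact: cvg_cst.
(* Restricting to [PoA_domain] refines the filter [0^'+], so the limit of the upper bound along
   [0^'+] suffices. *)
- apply: cvg_trans; first exact: (cvg_app _ (cvg_within _)).
  have : mu^-1 * arrival_rate h xe @[xe --> 0^'+] --> (0 : R).
    by rewrite -[X in _ --> X](mulr0 mu^-1); apply: cvgMr; exact: arrival_rate_cvg0.
  by move=> /(cvgD (cvg_cst (1 : R))); rewrite addr0.
Unshelve. all: by end_near. Qed.
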